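(* Let $P$ be a finite non-empty poset and let $n\ge 1$ be an integer. Then $$R(P,Q_n)\le \min\bigl\{N>n : \text{for some } \mathcal{Y}\subseteq [N] \text{ with } |\mathcal{Y}|=N-n \text{ there is no } P\text{-free } \mathcal{Y}\text{-blocker in } \mathcal{Q}([N])\bigr\}.$$
   Context: $[N]=\{1,\dots,N\}$. For a finite set $\mathcal{Z}$, $\mathcal{Q}(\mathcal{Z})$ denotes the Boolean lattice on $\mathcal{Z}$, i.e. the poset of all subsets of $\mathcal{Z}$ ordered by inclusion; $Q_n$ is the Boolean lattice on an $n$-element set. Elements of posets are called vertices. A copy of a poset $P$ in a poset $P'$ is an induced subposet of $P'$ isomorphic to $P$; a poset is $P$-free if it contains no (induced) copy of $P$. For posets $P,Q$, $R(P,Q)$ is the least positive integer $N$ such that every coloring of the vertices of $Q_N$ in blue and red contains a copy of $P$ with all vertices blue or a copy of $Q$ with all vertices red. Let $\mathcal{Y}\subseteq\mathcal{Z}$ with $\mathcal{Y}\ne\varnothing$ and let $\mathcal{X}=\mathcal{Z}\setminus\mathcal{Y}$. An embedding $\psi\colon\mathcal{Q}(\mathcal{X})\to\mathcal{Q}(\mathcal{Z})$ (an injective map with $X\subseteq X'$ if and only if $\psi(X)\subseteq\psi(X')$) is $\mathcal{X}$-good if $\psi(X)\cap\mathcal{X}=X$ for every $X\subseteq\mathcal{X}$. An $\mathcal{X}$-good copy of $\mathcal{Q}(\mathcal{X})$ in $\mathcal{Q}(\mathcal{Z})$ is the image of an $\mathcal{X}$-good embedding. A $\mathcal{Y}$-blocker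 in $\mathcal{Q}(\mathcal{Z})$ is an induced subposet of $\mathcal{Q}(\mathcal{Z})$ that contains a vertex from every $\mathcal{X}$-good copy of $\mathcal{Q}(\mathcal{X})$. *)

(* Defs.v *)
From mathcomp Require Import all_boot all_order.

Set Implicit Arguments.
Unset Strict Implicit.
Unset Printing Implicit Defensive.

Import Order.TTheory.
(* Gives [{set T}] its inclusion order, so that [{set T}] is the Boolean lattice
   on [T] and [{set 'I_n}] is Q_n. *)
Export Order.DefaultSetSubsetOrder.

(* Induced subposets are represented by their sets of vertices. *)
Section Copies.
Variables (d d' : Order.disp_t) (P : finPOrderType d) (P' : finPOrderType d').

Definition embedding (f : {ffun P -> P'}) : bool :=
  injectiveb f && [forall x, forall y, (x <= y)%O == (f x <= f y)%O].

Definition is_copy (C : {set P'}) : bool :=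
  [exists f : {ffun P -> P'}, embedding f && (C == [set f x | x : P])].

Definition poset_free (F : {set P'}) : bool :=
  ~~ [exists C : {set P'}, is_copy C && (C \subset F)].

Lemma embeddingP (f : {ffun P -> P'}) :
  reflect (forall x y, (x <= y)%O = (f x <= f y)%O) (embedding f).
Proof.
apply: (iffP idP) => [/andP[_ /forallP fP] x y | fP].
  exact/eqP/(forallP (fP x)).
apply/andP; split; last by apply/forallP=> x; apply/forallP=> y; apply/eqP.
by apply/injectiveP=> x y fxy; apply/le_anti; rewrite !fP fxy lexx.
Qed.

Lemma has_copyP (F : {set P'}) :
  reflect (exists f : P -> P',
             (forall x y, (x <= y)%O = (f x <= f y)%O) /\ forall x, f x \in F)
          [exists C : {set P'}, is_copy C && (C \subset F)].
Proof.
apply: (iffP existsP) => [[C /andP[/existsP[f /andP[/embeddingP fP /eqP->]]]]|].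
  move=> /subsetP sF; exists f; split=> // x; apply: sF; exact: imset_f.
move=> [f [fP fF]]; exists [set [ffun x => f x] x | x : P].
apply/andP; split; last by apply/subsetP=> _ /imsetP[x _ ->]; rewrite ffunE.
apply/existsP; exists [ffun x => f x]; rewrite eqxx andbT.
by apply/embeddingP=> x y; rewrite !ffunE.
Qed.

End Copies.

Arguments is_copy {d d'} P {P'} C.
Arguments poset_free {d d'} P {P'} F.

(* A colouring sends blue vertices to [true] and red vertices to [false]. *)
Definition ramsey_at (d d' : Order.disp_t) (P : finPOrderType d)
    (Q : finPOrderType d') (N : nat) : bool :=
  [forall c : {ffun {set 'I_N} -> bool},
     [exists C : {set {set 'I_N}}, is_copy P C && [forall v in C, c v]]
  || [exists C : {set {set 'I_N}}, is_copy Q C && [forall v in C, ~~ c v]]].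

Section Blockers.
Variable Z : finType.

(* The lattice Q(X) of a subset [X] of [Z] is the lattice of sets over the
   subtype [{z | z \in X}]; [[set val z | z in A]] is [A] seen inside [Z]. *)
Definition good_embedding (X : {set Z})
    (psi : {ffun {set {z | z \in X}} -> {set Z}}) : bool :=
  embedding psi && [forall A, psi A :&: X == [set val z | z in A]].

Definition good_copy (X : {set Z}) (C : {set {set Z}}) : bool :=
  [exists psi : {ffun {set {z | z \in X}} -> {set Z}},
     good_embedding psi && (C == [set psi A | A : {set {z | z \in X}}])].

Definition blocker (Y : {set Z}) (B : {set {set Z}}) : bool :=
  [forall C, good_copy (~: Y) C ==> [exists v in C, v \in B]].

End Blockers.

(* Since n < N, the sets [Y] considered here are nonempty. *)
Definition no_free_blocker_at (d : Order.disp_t) (P : finPOrderType d)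
    (n N : nat) : bool :=
  (n < N) && [exists Y : {set 'I_N}, (#|Y| == N - n) &&
    ~~ [exists B : {set {set 'I_N}}, blocker Y B && poset_free P B]].

(* The next lemmas show that [ramsey_at P Q] and [no_free_blocker_at P n] hold
   for some N, so that the two minima at the end of the file exist. *)

Lemma image_subset (S T : finType) (h : S -> T) (A B : {set S}) :
  injective h -> (h @: A \subset h @: B) = (A \subset B).
Proof.
move=> h_inj; apply/idP/idP => [/subsetP s | /imsetS -> //].
by apply/subsetP=> x xA; rewrite -(mem_imset _ _ h_inj) s ?imset_f.
Qed.

Section Ramsey.
Variables (d d' : Order.disp_t) (P : finPOrderType d) (Q : finPOrderType d').

(* For each [p], [q |-> layer p q] is a copy of [Q]; these copies are arranged
   like [P], so that choosing one vertex in each of them gives a copy of [P]. *)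
Let rk (p : P) := #|[set x : P | (x < p)%O]|.
Let T : finType := option (P + 'I_#|P|.+1 * Q)%type.
Let layer (p : P) (q : Q) : {set T} :=
  [set z : T | match z with
               | None => false
               | Some (inl x) => (x <= p)%O
               | Some (inr jy) =>
                   (jy.1 < rk p) || (jy.1 == rk p :> nat) && (jy.2 <= q)%O
               end].

Let rk_ord p : rk p < #|P|.+1. Proof. by rewrite ltnS max_card. Qed.

Let layer_le p q q' : (q <= q')%O = (layer p q \subset layer p q').
Proof.
apply/idP/subsetP => [qq' [[x|[j y]]|] | /(_ (Some (inr (Ordinal (rk_ord p), q))))].
- by rewrite !inE.
- by rewrite !inE /= => /orP[->//|/andP[-> /le_trans->]//]; rewrite orbT.
- by rewrite inE.
- by rewrite !inE /= ltnn eqxx /= lexx; apply.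
Qed.

Let layer_lt p p' q q' : (p < p')%O -> layer p q \subset layer p' q'.
Proof.
move=> pp'; have rkpp' : rk p < rk p'.
  apply/proper_card/properP; split.
    by apply/subsetP=> x; rewrite !inE => /lt_trans; apply.
  by exists p; rewrite !inE // ltxx.
apply/subsetP=> -[[x|[j y]]|]; rewrite !inE //=.
  by move=> /le_trans; apply; apply: ltW.
by move=> /orP[/ltn_trans->//|/andP[/eqP-> _]]; rewrite rkpp'.
Qed.

Let layer_sub p p' q q' : layer p q \subset layer p' q' -> (p <= p')%O.
Proof. by move/subsetP/(_ (Some (inl p))); rewrite !inE /= lexx; apply. Qed.

Lemma two_colours : exists2 N, 0 < N & forall c : {set 'I_N} -> bool,
    (exists f : P -> {set 'I_N},
       (forall x y, (x <= y)%O = (f x \subset f y)) /\ forall x, c (f x))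
 \/ (exists f : Q -> {set 'I_N},
       (forall x y, (x <= y)%O = (f x \subset f y)) /\ forall x, ~~ c (f x)).
Proof.
exists #|T|; first by rewrite card_option.
move=> c; pose up (A : {set T}) : {set 'I_#|T|} := enum_rank @: A.
have upS A B : (up A \subset up B) = (A \subset B).
  exact/image_subset/enum_rank_inj.
have [/existsP[p /forallP red] | blue] :=
    boolP [exists p, forall q, ~~ c (up (layer p q))].
  right; exists (fun q => up (layer p q)); split=> // x y.
  by rewrite upS -layer_le.
have {}blue p : exists q, c (up (layer p q)).
  move: blue; rewrite negb_exists => /forallP/(_ p).
  by rewrite negb_forall => /existsP[q]; rewrite negbK; exists q.
left; exists (fun p => up (layer p (xchoose (blue p)))); split; last first.
  by move=> x; exact: xchooseP (blue x).
move=> x y; rewrite upS; apply/idP/idP => [|/layer_sub//].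
by rewrite le_eqVlt => /orP[/eqP->|/layer_lt->].
Qed.

Lemma ramsey_exists : exists N, (0 < N) && ramsey_at P Q N.
Proof.
have [N N0 col] := two_colours; exists N; rewrite N0; apply/forallP=> c.
have copyI e (R : finPOrderType e) (b : pred {set 'I_N}) :
    (exists f : R -> {set 'I_N},
       (forall x y, (x <= y)%O = (f x \subset f y)) /\ forall x, b (f x)) ->
    [exists C : {set {set 'I_N}}, is_copy R C && [forall v in C, b v]].
  case=> f [fP bf]; have /has_copyP/existsP[C /andP[cC /subsetP sC]] :
      exists g : R -> {set 'I_N}, (forall x y, (x <= y)%O = (g x <= g y)%O) /\
        forall x, g x \in [set v | b v].
    by exists f; split=> // x; rewrite inE.
  apply/existsP; exists C; rewrite cC; apply/forall_inP=> v /sC.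
  by rewrite inE.
apply/orP; case: (col c) => h; [left; exact: copyI h | right].
exact: (copyI _ _ (fun v => ~~ c v)).
Qed.

End Ramsey.

Section FreeBlockers.
Variables (d : Order.disp_t) (P : finPOrderType d).

Lemma many_colours k : exists2 N, 0 < N & forall c : {set 'I_N} -> nat,
  (forall A, c A < k) -> exists i, exists f : P -> {set 'I_N},
    (forall x y, (x <= y)%O = (f x \subset f y)) /\ forall x, c (f x) = i.
Proof.
elim: k => [|k [M M0 IH]]; first by exists 1 => // c /(_ set0).
have [N N0 col] := @two_colours _ _ P {set 'I_M}; exists N => // c ck.
case: (col (fun A => c A == k)) => [[f [fP fk]] | [h [hP hk]]].
  by exists k, f; split=> // x; apply/eqP.
case: (IH (c \o h)) => [A | i [f [fP fi]]].
  by rewrite /= ltn_neqAle hk -ltnS ck.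
by exists i, (h \o f); split=> //= x y; rewrite -hP fP.
Qed.

Lemma no_free_blocker_exists n : exists N, no_free_blocker_at P n N.
Proof.
have [m m0 col] := many_colours #|{set 'I_n}|.
exists (n + m); apply/andP; split; first by rewrite -addn1 leq_add2l.
pose Y : {set 'I_(n + m)} := [set rshift n i | i : 'I_m].
apply/existsP; exists Y; apply/andP; split.
  by rewrite addKn card_imset ?card_ord //; exact: rshift_inj.
pose mk (A : {set 'I_n}) (D : {set 'I_m}) : {set 'I_(n + m)} :=
  (@lshift n m @: A) :|: (@rshift n m @: D).
have in_mk A D z : (z \in mk A D) =
    match split z with inl i => i \in A | inr j => j \in D end.
  rewrite -{1}(splitK z) inE; case: (split z) => i /=.
    rewrite (mem_imset _ _ (@lshift_inj _ _)) orbC.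
    by case: imsetP => // -[j _ /eqP]; rewrite eq_lrshift.
  rewrite (mem_imset _ _ (@rshift_inj _ _)).
  by case: imsetP => // -[j _ /eqP]; rewrite eq_rlshift.
have mkS A D D' : (mk A D \subset mk A D') = (D \subset D').
  apply/idP/idP => [/subsetP s | sD]; last exact/setUS/imsetS.
  apply/subsetP=> j jD; move/(_ (rshift n j)): s.
  by rewrite !in_mk -[rshift n j]/(unsplit (inr j)) unsplitK; apply.
apply/existsPn=> B; rewrite negb_and negbK -implybE; apply/implyP=> blB.
have blk D : exists A, mk A D \in B.
  pose psi : {ffun {set {z | z \in ~: Y}} -> {set 'I_(n + m)}} :=
    [ffun A : {set {z | z \in ~: Y}} => (val @: A) :|: (@rshift n m @: D)].
  have trace A : psi A :&: ~: Y = val @: A.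
    rewrite ffunE; apply/setP=> z; rewrite !inE.
    have [/imsetP[w _ ->]|zA] /= := boolP (z \in val @: A).
      by have := valP w; rewrite inE.
    by apply/andP=> -[/imsetP[j _ ->]]; rewrite imset_f.
  have : good_copy (~: Y) [set psi A | A : {set {z | z \in ~: Y}}].
    apply/existsP; exists psi; rewrite eqxx andbT; apply/andP; split.
      apply/embeddingP=> A A'; apply/idP/idP => [sA | sA].
        by rewrite !ffunE; apply/setSU/imsetS.
      by rewrite -[(_ <= _)%O](image_subset A A' val_inj) -!trace setSI.
    by apply/forallP=> A; apply/eqP/trace.
  move/(implyP (forallP blB _))=> /existsP[v /andP[/imsetP[A _ ->] vB]].
  exists (@lshift n m @^-1: (val @: A)).
  suff -> : mk (@lshift n m @^-1: (val @: A)) D = psi A by [].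
  rewrite ffunE; congr (_ :|: _); apply/setP=> z; apply/imsetP/idP => [|zA].
    by case=> i; rewrite inE => iA ->.
  have /imsetP[w _ zw] := zA; have := valP w; rewrite -zw inE => zY.
  case: (splitP z) zY => [i zi _|j zj /imsetP[]]; last first.
    by exists j => //; apply: val_inj.
  have {}zi : z = lshift m i by apply: val_inj.
  by exists i; rewrite // inE -zi.
have [D|i [f [fP fi]]] := col (fun D => enum_rank (xchoose (blk D))).
  exact: ltn_ord.
pose A0 p := xchoose (blk (f p)).
apply/has_copyP; exists (fun p => mk (A0 p) (f p)); split; last first.
  by move=> p; exact: xchooseP (blk (f p)).
move=> x y; have -> : A0 x = A0 y.
  by apply/enum_rank_inj/val_inj; rewrite /= !fi.
by rewrite [RHS]mkS fP.
Qed.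

End FreeBlockers.

Definition poset_ramsey (d d' : Order.disp_t) (P : finPOrderType d)
    (Q : finPOrderType d') : nat :=
  ex_minn (ramsey_exists P Q).

Definition min_no_free_blocker (d : Order.disp_t) (P : finPOrderType d)
    (n : nat) : nat :=
  ex_minn (no_free_blocker_exists P n).

(* Main.v *)
Require Import Defs.
From mathcomp Require Import all_boot all_order.

(** Let [N] be the right-hand minimum, [Y] the set of size [N - n] that comes
    with it, and colour Q([N]) in blue and red.  If there is no blue copy of
    [P], the set of blue vertices is [P]-free, so by the choice of [Y] it is not
    a [Y]-blocker: it misses some good copy of Q(X), where X is the complement
    of [Y].  That copy is red, and since [X] has [n] elements it is a copy of
    Q_n ([is_copy_iso] and [is_copy_card]).  Hence [N] has the Ramsey
    property. *)

Set Implicit Arguments.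
Unset Strict Implicit.
Unset Printing Implicit Defensive.

Lemma is_copy_iso (d1 d2 d : Order.disp_t) (P : finPOrderType d1)
    (Q : finPOrderType d2) (R : finPOrderType d) (h : Q -> P) (C : {set R}) :
  bijective h -> (forall x y, (x <= y)%O = (h x <= h y)%O) ->
  is_copy P C -> is_copy Q C.
Proof.
case=> h' hK h'K h_le /existsP[f /andP[/embeddingP f_le /eqP->]].
apply/existsP; exists [ffun x => f (h x)]; apply/andP; split.
  by apply/embeddingP=> x y; rewrite !ffunE h_le f_le.
apply/eqP/setP=> v; apply/imsetP/imsetP => -[x _ ->].
  by exists (h' x); rewrite // ffunE h'K.
by exists (h x); rewrite // ffunE.
Qed.

Lemma is_copy_card (S T : finType) (d : Order.disp_t) (R : finPOrderType d)
    (C : {set R}) :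
  #|S| = #|T| -> is_copy {set T} C -> is_copy {set S} C.
Proof.
move=> cardST; pose g (x : S) : T := enum_val (cast_ord cardST (enum_rank x)).
pose g' (y : T) : S := enum_val (cast_ord (esym cardST) (enum_rank y)).
have gK : cancel g g' by move=> x; rewrite /g /g' enum_valK cast_ordK enum_rankK.
have g'K : cancel g' g.
  by move=> y; rewrite /g /g' enum_valK cast_ordKV enum_rankK.
apply: (@is_copy_iso _ _ _ _ _ _ (fun A : {set S} => g @: A)) => [|A B].
  exists (fun B : {set T} => g' @: B) => A.
    by rewrite -imset_comp (eq_imset _ gK) imset_id.
  by rewrite -imset_comp (eq_imset _ g'K) imset_id.
exact/esym/image_subset/can_inj/gK.
Qed.

Lemma good_copy_is_copy (Z : finType) (X : {set Z}) (C : {set {set Z}}) :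
  good_copy X C -> is_copy {set 'I_#|X|} C.
Proof.
case/existsP=> psi /andP[/andP[psi_emb _] C_im].
apply: (@is_copy_card _ {z | z \in X}); first by rewrite card_ord card_sig.
by apply/existsP; exists psi; rewrite psi_emb.
Qed.

Lemma no_free_blocker_ramsey (d : Order.disp_t) (P : finPOrderType d)
    (n N : nat) :
  no_free_blocker_at P n N -> ramsey_at P {set 'I_n} N.
Proof.
case/andP=> ltnN /existsP[Y /andP[/eqP cardY /existsPn no_blocker]].
have cardX : #|~: Y| = n by rewrite cardsCs setCK cardY card_ord subKn // ltnW.
apply/forallP=> c; pose blue := [set v | c v].
have := no_blocker blue; rewrite negb_and negbK orbC.
case/orP=> [/existsP[C /andP[copyC /subsetP C_blue]] | /forallPn[C]].
  apply/orP; left; apply/existsP; exists C; rewrite copyC.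
  by apply/forall_inP=> v /C_blue; rewrite inE.
rewrite negb_imply => /andP[/good_copy_is_copy copyC /exists_inPn C_red].
rewrite cardX in copyC.
apply/orP; right; apply/existsP; exists C; rewrite copyC.
by apply/forall_inP=> v /C_red; rewrite inE.
Qed.

Theorem theorem9 (d : Order.disp_t) (P : finPOrderType d) (n : nat)
    (P_nonempty : 0 < #|P|) (n_ge1 : 1 <= n) :
  poset_ramsey P {set 'I_n} <= min_no_free_blocker P n.
Proof.
rewrite /poset_ramsey /min_no_free_blocker.
case: (ex_minnP (no_free_blocker_exists P n)) => N N_blocker _.
case: ex_minnP => M _; apply.
have /andP[ltnN _] := N_blocker.
by rewrite (leq_ltn_trans (leq0n n) ltnN) no_free_blocker_ramsey.
Qed.
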